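(* Let $d,\gamma>0$, let $(\vec r,\vec r_\Gamma)\in[\mathbb{W}^{1,\infty}]^N$ be real-valued, $(a,a_\Gamma)\in\mathbb{L}^\infty$, $U_T=(u_T,u_{T,\Gamma})\in\mathbb{L}^2$, and let $\mathcal{F}\subset L^2(0,T;\mathbb{L}^2)$ be bounded, closed and convex. For $F=(f,f_\Gamma)\in L^2(0,T;\mathbb{L}^2)$ let $Y(\cdot,\cdot;F)=(y(\cdot,\cdot;F),y_\Gamma(\cdot,\cdot;F))$ be the weak solution of $$\begin{cases} i\partial_t y+d\Delta y+i\vec r\cdot\nabla y+a(x)y=f & \text{in }Q,\\ i\partial_t y_\Gamma-d\partial_\nu y+\gamma\Delta_\Gamma y_\Gamma+i\vec r_\Gamma\cdot\nabla_\Gamma y_\Gamma+a_\Gamma(x)y_\Gamma=f_\Gamma & \text{on }\Sigma,\\ y|_\Gamma=y_\Gamma & \text{on }\Sigma,\\ (y(\cdot,0),y_\Gamma(\cdot,0))=(0,0) & \text{in }\Omega\times\Gamma,\end{cases}$$ and let $J(F)=\tfrac12\|y(\cdot,T;F)-u_T\|_{L^2(\Omega)}^2+\tfrac12\|y_\Gamma(\cdot,T;F)-u_{T,\Gamma}\|_{L^2(\Gamma)}^2$. Let $\mathcal{V}\subset\mathcal{F}$ be closed and convex, and suppose that for every $F\in\mathcal{V}$ and every $\delta F\neq0$ with $F+\delta F\in\mathcal{V}$, $$\int_\Omega|\delta y(\cdot,T;F)|^2\,dx+\int_\Gamma|\delta y_\Gamma(\cdot,T;F)|^2\,d\sigma>0,$$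 where $\delta y(\cdot,\cdot;F)=y(\cdot,\cdot;F+\delta F)-y(\cdot,\cdot;F)$ and $\delta y_\Gamma(\cdot,\cdot;F)=y_\Gamma(\cdot,\cdot;F+\delta F)-y_\Gamma(\cdot,\cdot;F)$. Then the inverse source problem admits at most one (quasi-)solution in $\mathcal{V}$, i.e. there is at most one $F^*\in\mathcal{V}$ with $J(F^* )=\inf_{F\in\mathcal{F}}J(F)$.
   Context: All function spaces consist of complex-valued functions unless said otherwise. $\Omega\subset\mathbb{R}^N$ ($N\ge1$) is a bounded domain with boundary $\Gamma=\partial\Omega$ of class $C^2$, $\nu$ is the outer unit normal, $T>0$, $Q=\Omega\times(0,T)$, $\Sigma=\Gamma\times(0,T)$. $\partial_\nu y=(\nabla y\cdot\nu)|_\Gamma$; $\nabla_\Gamma$ is the tangential gradient, $\nabla_\Gamma y=\nabla y-(\partial_\nu y)\nu$; $\Delta_\Gamma$ is the Laplace-Beltrami operator on $\Gamma$. $\mathbb{L}^p=L^p(\Omega,dx)\times L^p(\Gamma,d\sigma)$, with $\sigma$ the surface measure; $\mathbb{L}^2$ has the real inner product $\langle(y,y_\Gamma),(z,z_\Gamma)\rangle_{\mathbb{L}^2}=\Re\int_\Omega y\overline z\,dx+\Re\int_\Gamma y_\Gamma\overline{z_\Gamma}\,d\sigma$. For $k\in\mathbb{N}$, $\mathbb{W}^{k,p}=\{(y,y_\Gamma)\in W^{k,p}(\Omega)\times W^{k,p}(\Gamma): y|_\Gamma=y_\Gamma\}$ with its natural norm, and $\mathbb{H}^k=\mathbb{W}^{k,2}$.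 $[\mathbb{W}^{1,\infty}]^N$ denotes pairs of $N$-vector fields whose components lie in $\mathbb{W}^{1,\infty}$ (so $\vec r|_\Gamma=\vec r_\Gamma$). Inverse source problem: recover $F\in\mathcal{F}$ from the final-time data $U_T$; it is understood in the quasi-solution sense, as minimization of $J$ over $\mathcal{F}$. Weak solution: let $A:\mathbb{H}^2\subset\mathbb{L}^2\to\mathbb{L}^2$, $A(u,u_\Gamma)=(id\Delta u-\vec r\cdot\nabla u,\ -id\partial_\nu u+i\gamma\Delta_\Gamma u_\Gamma-\vec r_\Gamma\cdot\nabla_\Gamma u_\Gamma)$, with adjoint $A^*$. The system is $Y'=AY+i(a,a_\Gamma)Y-iF$, $Y(0)=0$ (componentwise multiplication). A weak solution is $Y\in C^0([0,T];\mathbb{L}^2)$ with $Y(0)=0$ such that for each $V\in D(A^* )$ the map $t\mapsto\langle Y(t),V\rangle_{\mathbb{L}^2}$ is absolutely continuous with derivative $\langle Y(t),A^*V\rangle_{\mathbb{L}^2}+\langle i(a,a_\Gamma)Y(t)-iF(t),V\rangle_{\mathbb{L}^2}$ for a.e. $t$. For every $F\in L^1(0,T;\mathbb{L}^2)$ there is a unique weak solution. *)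

(* Defs.v *)
From HB Require Import structures.
From mathcomp Require Import all_boot all_order all_algebra.
From mathcomp Require Import complex.
From mathcomp Require Import all_classical all_reals all_analysis.

Set Implicit Arguments.
Unset Strict Implicit.
Unset Printing Implicit Defensive.

Import Order.TTheory GRing.Theory Num.Theory.
Import numFieldNormedType.Exports.

Local Open Scope classical_set_scope.
Local Open Scope ring_scope.
Local Open Scope complex_scope.

Section OuterMeasures.
Context {R : realType} {T : pointedType}.

(* [mu_ext] is the library's outer measure generated by a weight on a
   semiring of sets.  Taking every subset as measurable lets it be used with
   an arbitrary weight; sets that may not occur in a cover get weight +oo. *)
Definition allsets : Type := T.

HB.instance Definition _ := Pointed.on allsets.
HB.instance Definition _ := @isMeasurable.Build default_measure_display
  allsets discrete_measurable discrete_measurable0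
  discrete_measurableC discrete_measurableU.

Definition cover_outer (w : set T -> \bar R) : set T -> \bar R :=
  @mu_ext _ allsets R w.

(* The restriction of an outer measure to a set D, A |-> mu (A n D); it needs
   no measurability of D. *)
Definition restr_outer (mu : set T -> \bar R) (D : set T) : set T -> \bar R :=
  fun A => mu (A `&` D).

Section Restriction.
Variables (mu : {outer_measure set T -> \bar R}) (D : set T).

Let restr_outer0 : restr_outer mu D set0 = 0%E.
Proof. by rewrite /restr_outer set0I outer_measure0. Qed.

Let restr_outer_ge0 A : (0 <= restr_outer mu D A)%E.
Proof. exact: outer_measure_ge0. Qed.

Let le_restr_outer : {homo restr_outer mu D : A B / A `<=` B >-> (A <= B)%E}.
Proof. by move=> A B AB; apply: le_outer_measure; exact: setSI. Qed.

Let restr_outer_sigma_subadditive : sigma_subadditive (restr_outer mu D).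
Proof.
move=> F; rewrite /restr_outer setI_bigcupl.
exact: outer_measure_sigma_subadditive.
Qed.

HB.instance Definition _ := isOuterMeasure.Build R T (restr_outer mu D)
  restr_outer0 restr_outer_ge0 le_restr_outer restr_outer_sigma_subadditive.

End Restriction.

End OuterMeasures.
Arguments allsets : clear implicits.

Section LebesgueHausdorff.
Context {R : realType} {n : nat}.
Local Notation pt := 'rV[R]_n.
Implicit Types (A E D : set pt) (a b x y : pt).

Definition box a b : set pt :=
  [set x | forall i, a ord0 i < x ord0 i <= b ord0 i].

Definition box_weight E : \bar R :=
  if E == set0 then 0%E else
  ereal_inf [set (\prod_i (p.2 ord0 i - p.1 ord0 i))%:E
            | p in [set p : pt * pt | E = box p.1 p.2]].

Definition lebesgue_outer A : \bar R := cover_outer box_weight A.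

Definition enorm x : R := Num.sqrt (\sum_i x ord0 i ^+ 2).

Definition ediam E : \bar R :=
  ereal_sup [set (enorm (p.1 - p.2))%:E | p in [set p : pt * pt | E p.1 /\ E p.2]].

(* omega_s = (2 pi / s) omega_(s-2); with this factor and Euclidean diameters
   the Hausdorff measure below is the surface measure on C^1 surfaces. *)
Fixpoint unit_ball_volume (s : nat) : R :=
  match s with
  | 0 => 1
  | 1 => 2
  | s'.+2 => 2 * pi / s%:R * unit_ball_volume s'
  end.

Definition hausdorff_weight (s : nat) (delta : R) E : \bar R :=
  if E == set0 then 0%E else
  if (ediam E <= delta%:E)%E
  then (unit_ball_volume s * (fine (ediam E) / 2) ^+ s)%:E else +oo%E.

Definition hausdorff_premeasure (s : nat) (delta : R) A : \bar R :=
  cover_outer (hausdorff_weight s delta) A.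

Definition hausdorff_outer (s : nat) A : \bar R :=
  ereal_sup [set hausdorff_premeasure s delta A
            | delta in [set delta : R | 0 < delta]].

Lemma box_weight0 : box_weight set0 = 0%E.
Proof. by rewrite /box_weight eqxx. Qed.

Lemma box_weight_ge0 E : (0 <= box_weight E)%E.
Proof.
rewrite /box_weight; case: (eqVneq E set0) => // /set0P[x Ex].
apply: le_ereal_inf_tmp => _ [[a b] /= Eab <-].
rewrite lee_fin; apply: prodr_ge0 => i _; rewrite subr_ge0.
by move: Ex; rewrite Eab => /(_ i)/andP[/lt_le_trans h /h/ltW].
Qed.

HB.instance Definition _ := isOuterMeasure.Build R pt lebesgue_outer
  (@mu_ext0 _ (allsets pt) R _ box_weight0 box_weight_ge0)
  (@mu_ext_ge0 _ (allsets pt) R _ box_weight_ge0)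
  (@le_mu_ext _ (allsets pt) R box_weight)
  (@mu_ext_sigma_subadditive _ (allsets pt) R _ box_weight_ge0).

Lemma unit_ball_volume_ge0 s : 0 <= unit_ball_volume s.
Proof.
suff: 0 <= unit_ball_volume s /\ 0 <= unit_ball_volume s.+1 by case.
elim: s => [|s [IH1 IH2]]; first by split=> /=; rewrite ?ler01 ?ler0n.
split=> //; rewrite [unit_ball_volume _]/=; apply: mulr_ge0 => //.
by rewrite divr_ge0 ?mulr_ge0 ?pi_ge0.
Qed.

Lemma hausdorff_weight0 s delta : hausdorff_weight s delta set0 = 0%E.
Proof. by rewrite /hausdorff_weight eqxx. Qed.

Lemma hausdorff_weight_ge0 s delta E : (0 <= hausdorff_weight s delta E)%E.
Proof.
rewrite /hausdorff_weight; case: (eqVneq E set0) => // /set0P[x Ex].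
case: ifP => // _; rewrite lee_fin mulr_ge0 ?unit_ball_volume_ge0//.
rewrite exprn_ge0// divr_ge0// fine_ge0//.
apply: le_trans (ereal_sup_ubound _); last by exists (x, x).
by rewrite lee_fin sqrtr_ge0.
Qed.

Let hausdorff_outer0 s : hausdorff_outer s set0 = 0%E.
Proof.
rewrite /hausdorff_outer (_ : image _ _ = [set 0%E]) ?ereal_sup1//.
apply/seteqP; split => [_ [d _ <-]|_ ->] /=.
  exact: (@mu_ext0 _ (allsets pt) R _ (hausdorff_weight0 s d)
    (hausdorff_weight_ge0 s d)).
exists 1 => //=; exact: (@mu_ext0 _ (allsets pt) R _ (hausdorff_weight0 s 1)
    (hausdorff_weight_ge0 s 1)).
Qed.

Let hausdorff_outer_ge0 s A : (0 <= hausdorff_outer s A)%E.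
Proof.
apply: (@le_trans _ _ (hausdorff_premeasure s 1 A)).
  exact: (@mu_ext_ge0 _ (allsets pt) R _ (hausdorff_weight_ge0 s 1)).
by apply: ereal_sup_ubound; exists 1 => //=.
Qed.

Let le_hausdorff_outer s :
  {homo hausdorff_outer s : A B / A `<=` B >-> (A <= B)%E}.
Proof.
move=> A B AB; apply: ge_ereal_sup => _ [d d0 <-].
apply: le_trans (ereal_sup_ubound _); last by exists d.
exact: (@le_mu_ext _ (allsets pt) R (hausdorff_weight s d)).
Qed.

Let hausdorff_outer_sigma_subadditive s :
  sigma_subadditive (hausdorff_outer s).
Proof.
move=> F; apply: ge_ereal_sup => _ [d d0 <-].
apply: (le_trans (@mu_ext_sigma_subadditive _ (allsets pt) R _
  (hausdorff_weight_ge0 s d) F)).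
apply: lee_nneseries => [i _ _|i _].
  exact: (@mu_ext_ge0 _ (allsets pt) R _ (hausdorff_weight_ge0 s d)).
by apply: ereal_sup_ubound; exists d.
Qed.

HB.instance Definition _ s := isOuterMeasure.Build R pt (hausdorff_outer s)
  (hausdorff_outer0 s) (hausdorff_outer_ge0 s) (@le_hausdorff_outer s)
  (@hausdorff_outer_sigma_subadditive s).

End LebesgueHausdorff.

Section ComplexLp.
Context {d : measure_display} {T : measurableType d} {R : realType}.
Variable mu : {measure set T -> \bar R}.
Implicit Type f : T -> R[i].

Definition cLp (p : \bar R) f : Prop :=
  (fun x => complex.Re (f x)) \in Lfun mu p /\
  (fun x => complex.Im (f x)) \in Lfun mu p.

Definition cint f : R[i] :=
  Rintegral mu setT (fun x => complex.Re (f x))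
  +i* Rintegral mu setT (fun x => complex.Im (f x)).

Definition sqmod (z : R[i]) : R := complex.Re z ^+ 2 + complex.Im z ^+ 2.

Definition L2sq f : \bar R := \int[mu]_x (sqmod (f x))%:E.

End ComplexLp.

Section Smooth.
Context {R : realType} {N : nat}.
Local Notation pt := 'rV[R]_N.
Implicit Types (phi : pt -> R) (f : pt -> R[i]).

Definition basis_vec (j : 'I_N) : pt := delta_mx ord0 j.

Definition pd (j : 'I_N) phi : pt -> R := fun x => 'D_(basis_vec j) phi x.

Definition gradient phi (x : pt) : pt := \row_j pd j phi x.

Fixpoint classC (k : nat) phi : Prop :=
  continuous phi /\
  match k with
  | 0 => True
  | k'.+1 => forall j, (forall x, derivable phi x (basis_vec j)) /\
                       classC k' (pd j phi)
  end.

Definition smooth phi : Prop := forall k, classC k phi.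

Definition csmooth f : Prop :=
  smooth (fun x => complex.Re (f x)) /\ smooth (fun x => complex.Im (f x)).

Definition cpd (j : 'I_N) f : pt -> R[i] := fun x =>
  pd j (fun y => complex.Re (f y)) x +i* pd j (fun y => complex.Im (f y)) x.

Definition test_function (Omega : set pt) phi : Prop :=
  smooth phi /\
  exists2 K : set pt, compact K /\ K `<=` Omega &
    forall x, ~ K x -> phi x = 0.

End Smooth.

Section Domain.
Context {R : realType} {N : nat}.
Local Notation pt := 'rV[R]_N.
Variable Omega : set pt.
Implicit Types (u g : pt -> R[i]) (x : pt).

Definition boundary : set pt := closure Omega `\` Omega°.

(* Near x0 and up to the choice of the coordinate x_j and of its orientation,
   Omega is the open epigraph of a C^2 function of the other coordinates. *)
Definition local_graph x0 (r : R) (j : 'I_N) (s : bool) (h : pt -> R) : Prop :=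
  [/\ 0 < r, classC 2 h,
      forall x t, h (x + t *: basis_vec j) = h x &
      forall x, ball x0 r x -> (Omega x <-> h x < (-1) ^+ s * x ord0 j)].

Definition bounded_C2_domain : Prop :=
  [/\ Omega !=set0, open Omega, connected Omega, bounded_set Omega &
      forall x0, boundary x0 -> exists r j s h, local_graph x0 r j s h].

(* The outer unit normal: the normalized gradient of h(x) - (-1)^s x_j, which
   is negative in Omega. *)
Definition outer_normal x : pt :=
  xget 0 [set n | exists r j s h, local_graph x r j s h /\
    let v := gradient h x - (-1) ^+ s *: basis_vec j in
    n = (enorm v)^-1 *: v].

Local Notation nu x i := (outer_normal x ord0 i).

(* dx on Omega: Lebesgue measure of R^N restricted to Omega, on its
   Caratheodory sigma-algebra. *)
Definition dx_outer : {outer_measure set pt -> \bar R} :=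
  restr_outer lebesgue_outer Omega.
Definition dx : {measure set (caratheodory_type dx_outer) -> \bar R} :=
  (dx_outer : set (caratheodory_type dx_outer) -> \bar R).

(* dsigma on the boundary: (N-1)-dimensional Hausdorff measure. *)
Definition ds_outer : {outer_measure set pt -> \bar R} :=
  restr_outer (hausdorff_outer N.-1) boundary.
Definition ds : {measure set (caratheodory_type ds_outer) -> \bar R} :=
  (ds_outer : set (caratheodory_type ds_outer) -> \bar R).

(* Elements of L^p(Omega) and L^p(Gamma) are represented by functions on R^N;
   values outside Omega, resp. outside Gamma, are irrelevant. *)
Definition LpO (p : \bar R) u : Prop := cLp dx p u.
Definition LpG (p : \bar R) u : Prop := cLp ds p u.

Definition is_weak_grad u (G : 'I_N -> pt -> R[i]) : Prop :=
  (forall j, LpO 1 (G j)) /\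
  forall j phi, test_function Omega phi ->
    cint dx (fun x => u x * (pd j phi x)%:C) =
    - cint dx (fun x => G j x * (phi x)%:C).

Fixpoint WkpO (k : nat) (p : \bar R) u : Prop :=
  LpO p u /\
  match k with
  | 0 => True
  | k'.+1 => exists2 G, is_weak_grad u G & forall j, WkpO k' p (G j)
  end.

(* Weak derivatives and traces are unique up to null sets; the operators below
   select one representative. *)
Definition grad u : 'I_N -> pt -> R[i] := xget 0 [set G | is_weak_grad u G].

Definition laplacian u : pt -> R[i] := fun x => \sum_j grad (grad u j) j x.

(* The trace: limit in L^2(Gamma) of the boundary values of smooth functions
   converging to u in H^1(Omega). *)
Definition is_trace u g : Prop :=
  [/\ WkpO 1 2%:E u, LpG 2%:E g &
   exists2 phi : nat -> pt -> R[i], forall m, csmooth (phi m) &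
   [/\ (fun m => L2sq dx (phi m - u)) @ \oo --> 0%E,
       forall j, (fun m => L2sq dx (cpd j (phi m) - grad u j)) @ \oo --> 0%E &
       (fun m => L2sq ds (phi m - g)) @ \oo --> 0%E]].

Definition trace u : pt -> R[i] := xget 0 [set g | is_trace u g].

Definition normal_derivative u : pt -> R[i] :=
  fun x => \sum_j trace (grad u j) x * (nu x j)%:C.

(* nabla phi - (d_nu phi) nu for phi of class C^1 near Gamma. *)
Definition tgrad_smooth (phi : pt -> R) (i : 'I_N) : pt -> R := fun x =>
  pd i phi x - (\sum_j pd j phi x * nu x j) * nu x i.

Definition tangential_field (X : 'I_N -> pt -> R) : Prop :=
  (forall i, classC 1 (X i)) /\
  forall x, boundary x -> \sum_i X i x * nu x i = 0.

Definition tdiv_smooth (X : 'I_N -> pt -> R) : pt -> R :=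
  fun x => \sum_i tgrad_smooth (X i) i x.

(* The tangential gradient, in the weak sense given by the divergence theorem
   on the closed surface Gamma. *)
Definition is_weak_tgrad g (G : 'I_N -> pt -> R[i]) : Prop :=
  [/\ forall i, LpG 1 (G i),
      {ae ds, forall x, \sum_i G i x * (nu x i)%:C = 0} &
      forall X, tangential_field X ->
        cint ds (fun x => g x * (tdiv_smooth X x)%:C) =
        - cint ds (fun x => \sum_i G i x * (X i x)%:C)].

Fixpoint WkpG (k : nat) (p : \bar R) g : Prop :=
  LpG p g /\
  match k with
  | 0 => True
  | k'.+1 => exists2 G, is_weak_tgrad g G & forall i, WkpG k' p (G i)
  end.

Definition tgrad g : 'I_N -> pt -> R[i] := xget 0 [set G | is_weak_tgrad g G].

(* div_Gamma nabla_Gamma, the Cartesian form of the Laplace-Beltrami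
   operator. *)
Definition laplace_beltrami g : pt -> R[i] :=
  fun x => \sum_i tgrad (tgrad g i) i x.

Definition state : Type := ((pt -> R[i]) * (pt -> R[i]))%type.
Implicit Types U V W : state.

Definition LL (p : \bar R) U : Prop := LpO p U.1 /\ LpG p U.2.

(* For p >= 2 and k >= 1; Omega being bounded, the L^2 notion of trace
   applies. *)
Definition WW (k : nat) (p : \bar R) U : Prop :=
  [/\ WkpO k p U.1, WkpG k p U.2 & is_trace U.1 U.2].

Definition scale (c : R[i]) U : state :=
  (fun x => c * U.1 x, fun x => c * U.2 x).

Definition inner U V : R :=
  complex.Re (cint dx (fun x => U.1 x * (V.1 x)^*)) +
  complex.Re (cint ds (fun x => U.2 x * (V.2 x)^*)).

Definition LLsq U : \bar R := (L2sq dx U.1 + L2sq ds U.2)%E.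

Definition LLeq U V : Prop :=
  {ae dx, forall x, U.1 x = V.1 x} /\ {ae ds, forall x, U.2 x = V.2 x}.

Section Time.
Variable T : R.
Implicit Types (F G : R -> state) (C : set (R -> state)).

Definition strongly_measurable F : Prop :=
  exists (m : nat -> nat) (A : nat -> nat -> set R) (u : nat -> nat -> state),
    (forall n k, measurable (A n k) /\ LL 2%:E (u n k)) /\
    {ae lebesgue_measure, forall t : R, t \in `]0, T[ ->
      (fun n => LLsq (\sum_(k < m n) scale (\1_(A n k) t)%:C (u n k) - F t))
        @ \oo --> 0%E}.

Definition L2Tsq F : \bar R :=
  \int[lebesgue_measure]_(t in `]0, T[) LLsq (F t).

Definition L2T F : Prop :=
  [/\ forall t, t \in `]0, T[ -> LL 2%:E (F t),
      strongly_measurable F & (L2Tsq F < +oo)%E].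

Definition L2Teq F G : Prop :=
  {ae lebesgue_measure, forall t : R, t \in `]0, T[ -> LLeq (F t) (G t)}.

Definition bounded_L2T C : Prop :=
  exists M : R, forall F, C F -> (L2Tsq F <= M%:E)%E.

Definition closed_L2T C : Prop :=
  forall (Fn : nat -> R -> state) F, (forall n, C (Fn n)) -> L2T F ->
    (fun n => L2Tsq (Fn n - F)) @ \oo --> 0%E -> C F.

Definition convex_L2T C : Prop :=
  forall F G (l : R), C F -> C G -> 0 <= l <= 1 ->
    C (fun t => scale l%:C (F t) + scale (1 - l)%:C (G t)).

Definition absolutely_continuous (phi : R -> R) : Prop :=
  forall e : R, 0 < e -> exists2 delta : R, 0 < delta &
    forall (m : nat) (a b : nat -> R),
      (forall k, (k < m)%N -> 0 <= a k /\ a k <= b k /\ b k <= T) ->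
      (forall k l, (k < m)%N -> (l < m)%N -> k != l ->
        b k <= a l \/ b l <= a k) ->
      \sum_(k < m) (b k - a k) < delta ->
      \sum_(k < m) `|phi (b k) - phi (a k)| < e.

Definition continuous_in_time (Y : R -> state) : Prop :=
  (forall t, t \in `[0, T] -> LL 2%:E (Y t)) /\
  forall t, t \in `[0, T] ->
    LLsq (Y s - Y t) @[s --> within `[0, T] (nbhs t)] --> 0%E.

Section System.
Variables (d gamma : R) (r rG : 'I_N -> pt -> R) (a aG : pt -> R[i]).

(* Its domain is [WW 2 2]. *)
Definition opA U : state :=
  (fun x => 'i * d%:C * laplacian U.1 x
            - \sum_j (r j x)%:C * grad U.1 j x,
   fun x => - ('i * d%:C * normal_derivative U.1 x)
            + 'i * gamma%:C * laplace_beltrami U.2 x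
            - \sum_j (rG j x)%:C * tgrad U.2 j x).

(* V is in D(A^* ) and A^* V = W; W is unique since D(A) is dense. *)
Definition is_adjoint V W : Prop :=
  [/\ LL 2%:E V, LL 2%:E W &
      forall U, WW 2 2%:E U -> inner (opA U) V = inner U W].

Definition potential U : state :=
  (fun x => a x * U.1 x, fun x => aG x * U.2 x).

Definition weak_solution F (Y : R -> state) : Prop :=
  [/\ continuous_in_time Y, LLeq (Y 0) 0 &
      forall V W, is_adjoint V W ->
        absolutely_continuous (fun t => inner (Y t) V) /\
        {ae lebesgue_measure, forall t : R, t \in `]0, T[ ->
          is_derive t (1 : R) (fun s => inner (Y s) V)
            (inner (Y t) W +
             inner (scale 'i (potential (Y t)) - scale 'i (F t)) V)}].

(* j = J(F). The weak solution of datum F is unique; J is given as a relation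
   so that this well-posedness result is not part of the definition. *)
Definition is_cost (UT : state) F (j : \bar R) : Prop :=
  exists2 Y, weak_solution F Y &
    j = (2^-1%:E * L2sq dx ((Y T).1 - UT.1)%R
         + 2^-1%:E * L2sq ds ((Y T).2 - UT.2)%R)%E.

Definition attains_inf_cost UT (FF : set (R -> state)) Fstar : Prop :=
  is_cost UT Fstar
    (ereal_inf [set j | exists2 F, FF F & is_cost UT F j]).

End System.
End Time.
End Domain.

(* Main.v *)
(* If [F1] and [F2] are minimizers in [V] that differ, their midpoint lies in
    [V] by convexity, and since the system is linear the average of the two
    weak solutions is a weak solution for it. By the parallelogram identity its
    cost is the minimum minus [1/8 |Y2 T - Y1 T|^2], and the last term is
    positive by the hypothesis on [V]: a contradiction. *)

Require Import Defs.
From mathcomp Require Import all_boot all_order all_algebra.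
From mathcomp Require Import complex ring lra.
From mathcomp Require Import all_classical all_reals all_analysis.
From mathcomp Require Import ess_sup_inf measurable_realfun.

Set Implicit Arguments.
Unset Strict Implicit.
Unset Printing Implicit Defensive.

Import Order.TTheory GRing.Theory Num.Theory.
Import numFieldNormedType.Exports.

Local Open Scope classical_set_scope.
Local Open Scope ring_scope.
Local Open Scope complex_scope.

(** * Pointwise identities for the squared modulus *)

Section ComplexParts.
Context {R : realType}.
Implicit Types (z w : R[i]) (l m : R).

Lemma Re_comb l m z w :
  complex.Re (l%:C * z + m%:C * w) = l * complex.Re z + m * complex.Re w.
Proof. by case: z => a b; case: w => a' b' /=; ring. Qed.

(** The parallelogram identity with weights. It is kept as an equality because the defect
    [l * m * sqmod (z - w)] is what makes the cost strictly smaller between two minimizers. *)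
Lemma sqmod_convex l m z w : l + m = 1 ->
  sqmod (l%:C * z + m%:C * w) + l * m * sqmod (z - w)
  = l * sqmod z + m * sqmod w.
Proof.
move=> lm; have -> : m = 1 - l by lra.
by case: z => a b; case: w => a' b'; rewrite /sqmod /=; ring.
Qed.

(** The right side minus the left side is the squared modulus of [l z - m w]. The weights are
    arbitrary reals, as in the superposition of solutions. *)
Lemma sqmod_comb_le l m z w :
  sqmod (l%:C * z + m%:C * w) <= 2 * l ^+ 2 * sqmod z + 2 * m ^+ 2 * sqmod w.
Proof.
case: z => a b; case: w => a' b'; rewrite /sqmod /= -subr_ge0.
rewrite (_ : _ - _ = (l * a - m * a') ^+ 2 + (l * b - m * b') ^+ 2).
  by rewrite addr_ge0 ?sqr_ge0.
by ring.
Qed.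

Lemma sqmod_ge0 z : 0 <= sqmod z.
Proof. by rewrite addr_ge0 ?sqr_ge0. Qed.

End ComplexParts.

(** * Real Lebesgue spaces: combinations, squares and products *)

Section RealLp.
Context {d : measure_display} {T : measurableType d} {R : realType}.
Variable mu : {measure set T -> \bar R}.
Implicit Types (f g : T -> R) (p : \bar R) (l m : R).

(* The search for a [Filter] instance fails when [filterS] is applied directly
   to [lebesgue_measure], [dx] or [ds]. *)
Lemma aeS (P Q : T -> Prop) : (forall x, P x -> Q x) ->
  {ae mu, forall x, P x} -> {ae mu, forall x, Q x}.
Proof. exact: filterS. Qed.

Lemma aeS2 (P Q S : T -> Prop) : (forall x, P x -> Q x -> S x) ->
  {ae mu, forall x, P x} -> {ae mu, forall x, Q x} -> {ae mu, forall x, S x}.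
Proof. exact: filterS2. Qed.

Lemma Lfun_measurable p f : f \in Lfun mu p -> measurable_fun setT f.
Proof. by rewrite inE => /andP[/[!inE]]. Qed.

Lemma eq_Lfun p f g : f =1 g -> f \in Lfun mu p -> g \in Lfun mu p.
Proof. by move=> /funext ->. Qed.

Lemma Lfun_comb p f g l m : (1 <= p)%E -> f \in Lfun mu p -> g \in Lfun mu p ->
  (fun x => l * f x + m * g x) \in Lfun mu p.
Proof.
move=> p1 fp gp; have [z ax] := Lfun_submod_closed mu p1.
have := ax m _ _ gp z; rewrite addr0 => mg.
by apply: eq_Lfun (ax l _ _ fp mg) => x.
Qed.

(** Removes the absolute value and the root from the norm, leaving the integral of a square that
    enters [sqmod]. *)
Lemma Lfun2P f : f \in Lfun mu 2%:E <->
  measurable_fun setT f /\ (\int[mu]_x (f x ^+ 2)%:E < +oo)%E.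
Proof.
split=> [f2|[mf f2]].
  split; first exact: Lfun_measurable f2.
  have /integrableP[_] := Lfun2_integrable_sqr f2.
  by under eq_integral => x _ do rewrite /= ger0_norm ?sqr_ge0//.
rewrite inE; apply/andP; split; rewrite inE//= /finite_norm unlock /=.
rewrite poweR_lty//.
under eq_integral => x _ do
  rewrite powR_mulrn ?normr_ge0// real_normK ?num_real//.
exact: f2.
Qed.

Lemma Lfuny_bounded f : f \in Lfun mu +oo%E ->
  exists M : R, {ae mu, forall x, `|f x| <= M}.
Proof.
rewrite inE => /andP[_]; rewrite inE/= /finite_norm unlock /=.
case: ifPn => [mu0|]; last first.
  (* On a space of measure zero every property holds almost everywhere, so the bound 0 will do;
     otherwise the essential supremum is the bound. *)
  rewrite -leNgt => mu0 _; exists 0.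
  have mueq0 : mu setT = 0%E by apply/eqP; rewrite eq_le mu0/=.
  exists setT; split => //.
move=> foo; exists (fine (ess_sup mu (abse \o (EFin \o f)))).
have := ess_sup_ge mu (abse \o (EFin \o f)).
apply: filterS => x /= fx.
rewrite -lee_fin fineK// ge0_fin_numE//.
by apply: le_trans fx; rewrite lee_fin.
Qed.

(** Almost everywhere [(f g)^2 <= M^2 g^2], with [M] an essential bound of [f]. This keeps the
    zeroth-order term of the system square integrable. *)
Lemma Lfuny_mul_Lfun2 f g : f \in Lfun mu +oo%E -> g \in Lfun mu 2%:E ->
  (fun x => f x * g x) \in Lfun mu 2%:E.
Proof.
move=> foo /Lfun2P[mg g2]; have mf := Lfun_measurable foo.
have [M fM] := Lfuny_bounded foo.
have mg2 : measurable_fun setT (fun x => (g x ^+ 2)%:E).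
  by apply/measurable_EFinP; exact: measurable_funX.
apply/Lfun2P; split; first exact: measurable_funM.
apply: (@le_lt_trans _ _ (\int[mu]_x ((M ^+ 2)%:E * (g x ^+ 2)%:E))%E).
  apply: ae_ge0_le_integral => //.
  - by move=> x _; rewrite lee_fin sqr_ge0.
  - by apply/measurable_EFinP; apply: measurable_funX; exact: measurable_funM.
  - by move=> x _; rewrite -EFinM lee_fin mulr_ge0 ?sqr_ge0.
  - by apply: measurable_funeM.
  - apply: filterS fM => x fM _; rewrite -EFinM lee_fin exprMn.
    rewrite ler_wpM2r ?sqr_ge0// -[leLHS]real_normK ?num_real//.
    (* [M] is nonnegative because it bounds [|f x|] at the point at hand. *)
    by rewrite lerXn2r ?nnegrE ?normr_ge0// (le_trans _ fM).
rewrite ge0_integralZl_EFin ?sqr_ge0//.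
  by rewrite lte_mul_pinfty ?lee_fin ?sqr_ge0.
by move=> x _; rewrite lee_fin sqr_ge0.
Qed.

End RealLp.

(** * Complex Lebesgue spaces: combinations, pairings and squared norms *)

Section ComplexLp.
Context {d : measure_display} {T : measurableType d} {R : realType}.
Variable mu : {measure set T -> \bar R}.
Implicit Types (f g h : T -> R[i]) (p : \bar R) (l m : R) (c e : R[i]).

Lemma ae_comb0 f g c e :
  {ae mu, forall x, f x = 0} -> {ae mu, forall x, g x = 0} ->
  {ae mu, forall x, c * f x + e * g x = 0}.
Proof. by apply: aeS2 => x -> ->; rewrite !mulr0 addr0. Qed.

Lemma cLp_comb p f g c e : (1 <= p)%E -> cLp mu p f -> cLp mu p g ->
  cLp mu p (fun x => c * f x + e * g x).
Proof.
case: c => a b; case: e => a' b' p1 [f1 f2] [g1 g2].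
(* Real and imaginary parts of [c f], then of [e g], as real combinations. *)
have F1 := Lfun_comb a (- b) p1 f1 f2; have F2 := Lfun_comb a b p1 f2 f1.
have G1 := Lfun_comb a' (- b') p1 g1 g2; have G2 := Lfun_comb a' b' p1 g2 g1.
split.
  apply: eq_Lfun (Lfun_comb 1 1 p1 F1 G1) => x.
  by case: (f x) => ? ?; case: (g x) => ? ? /=; ring.
apply: eq_Lfun (Lfun_comb 1 1 p1 F2 G2) => x.
by case: (f x) => ? ?; case: (g x) => ? ? /=; ring.
Qed.

Lemma cLpy_mul_cLp2 f g : cLp mu +oo%E f -> cLp mu 2%:E g ->
  cLp mu 2%:E (fun x => f x * g x).
Proof.
move=> [f1 f2] [g1 g2].
have M := @Lfuny_mul_Lfun2 _ _ _ mu.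
have two : (1 <= 2%:E :> \bar R)%E by rewrite lee_fin; lra.
split.
  apply: eq_Lfun (Lfun_comb 1 (-1) two (M _ _ f1 g1) (M _ _ f2 g2)) => x.
  by case: (f x) => ? ?; case: (g x) => ? ? /=; ring.
apply: eq_Lfun (Lfun_comb 1 1 two (M _ _ f1 g2) (M _ _ f2 g1)) => x.
by case: (f x) => ? ?; case: (g x) => ? ? /=; ring.
Qed.

(** The real part is [Re f Re h + Im f Im h], and each product of two square integrable functions is
    integrable by Hölder's inequality. *)
Lemma Re_mul_conj_integrable f h : cLp mu 2%:E f -> cLp mu 2%:E h ->
  mu.-integrable setT (EFin \o (fun x => complex.Re (f x * (h x)^*))).
Proof.
move=> [f1 f2] [h1 h2]; apply/Lfun1_integrable.
apply: eq_Lfun (Lfun_comb 1 1 (lexx 1%E) (Lfun2_mul_Lfun1 f1 h1)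
  (Lfun2_mul_Lfun1 f2 h2)) => x /=.
by case: (f x) => ? ?; case: (h x) => ? ? /=; ring.
Qed.

(** Square integrability makes both integrands integrable, so that the integral is additive; real
    weights pass through the real part. *)
Lemma Re_cint_comb f g h l m :
  cLp mu 2%:E f -> cLp mu 2%:E g -> cLp mu 2%:E h ->
  complex.Re (cint mu (fun x => (l%:C * f x + m%:C * g x) * (h x)^*)) =
  l * complex.Re (cint mu (fun x => f x * (h x)^*)) +
  m * complex.Re (cint mu (fun x => g x * (h x)^*)).
Proof.
move=> f2 g2 h2; have If := Re_mul_conj_integrable f2 h2.
have Ig := Re_mul_conj_integrable g2 h2.
rewrite /= -!RintegralZl// -RintegralD//; last 2 first.
- exact: (integrableZl measurableT l If).
- exact: (integrableZl measurableT m Ig).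
by apply: eq_Rintegral => x _; rewrite mulrDl -!mulrA Re_comb.
Qed.

Lemma cLp_measurable_sqmod p f : cLp mu p f ->
  measurable_fun setT (EFin \o (fun x => sqmod (f x))).
Proof.
move=> [/Lfun_measurable m1 /Lfun_measurable m2]; apply/measurable_EFinP.
by apply: measurable_funD; exact: measurable_funX.
Qed.

Lemma L2sq_ge0 f : (0 <= L2sq mu f)%E.
Proof. by apply: integral_ge0 => x _; rewrite lee_fin sqmod_ge0. Qed.

Lemma cLp_L2sq_lty f : cLp mu 2%:E f -> (L2sq mu f < +oo)%E.
Proof.
move=> [/Lfun2P[m1 l1] /Lfun2P[m2 l2]].
rewrite /L2sq /sqmod; under eq_integral => x _ do rewrite EFinD.
rewrite ge0_integralD//; first by rewrite lte_add_pinfty.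
- by move=> x _; rewrite lee_fin sqr_ge0.
- by apply/measurable_EFinP; exact: measurable_funX.
- by move=> x _; rewrite lee_fin sqr_ge0.
- by apply/measurable_EFinP; exact: measurable_funX.
Qed.

(** Linearity of the integral on nonnegative functions, whence the signs of [l] and [m]. *)
Lemma integral_sqmod_comb f g l m : 0 <= l -> 0 <= m -> cLp mu 2%:E f -> cLp mu 2%:E g ->
  (\int[mu]_x (l * sqmod (f x) + m * sqmod (g x))%:E
   = l%:E * L2sq mu f + m%:E * L2sq mu g)%E.
Proof.
move=> l0 m0 /cLp_measurable_sqmod mf /cLp_measurable_sqmod mg.
have ge0 h x : (0 <= (sqmod (h x))%:E :> \bar R)%E by rewrite lee_fin sqmod_ge0.
rewrite /L2sq -!ge0_integralZl_EFin// -ge0_integralD//.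
- by move=> x _; rewrite -EFinM lee_fin mulr_ge0 ?sqmod_ge0.
- exact: measurable_funeM.
- by move=> x _; rewrite -EFinM lee_fin mulr_ge0 ?sqmod_ge0.
- exact: measurable_funeM.
Qed.

(** The integrated form of [sqmod_convex]. The defect is a summand on the left, which avoids
    subtraction in the extended reals. *)
Lemma L2sq_convex f g l m : 0 <= l -> 0 <= m -> l + m = 1 ->
  cLp mu 2%:E f -> cLp mu 2%:E g ->
  (L2sq mu (fun x => l%:C * f x + m%:C * g x)%R
     + (l * m)%:E * L2sq mu (fun x => f x - g x)%R
   = l%:E * L2sq mu f + m%:E * L2sq mu g)%E.
Proof.
move=> l0 m0 lm f2 g2.
have two : (1 <= 2%:E :> \bar R)%E by rewrite lee_fin; lra.
have d2 := cLp_comb 1 (-1) two f2 g2.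
have := cLp_comb l%:C m%:C two f2 g2.
have -> : (fun x => f x - g x) = (fun x => 1 * f x + -1 * g x).
  by apply/funext => x; rewrite mul1r mulN1r.
(* A factor 1 on the first term gives the left side the shape of a combination, with weights 1 and
   [l * m]. *)
move=> c2; rewrite -integral_sqmod_comb// -[X in (X + _)%E]mul1e.
rewrite -integral_sqmod_comb ?mulr_ge0//.
by apply: eq_integral => x _; rewrite !mul1r mulN1r sqmod_convex.
Qed.

Lemma L2sq_comb_le f g l m : cLp mu 2%:E f -> cLp mu 2%:E g ->
  (L2sq mu (fun x => l%:C * f x + m%:C * g x)%R
   <= (2 * l ^+ 2)%:E * L2sq mu f + (2 * m ^+ 2)%:E * L2sq mu g)%E.
Proof.
move=> f2 g2; have two : (1 <= 2%:E :> \bar R)%E by rewrite lee_fin; lra.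
have cc := cLp_comb l%:C m%:C two f2 g2.
have mf := cLp_measurable_sqmod f2; have mg := cLp_measurable_sqmod g2.
have sq (k : R) : 0 <= 2 * k ^+ 2 by rewrite mulr_ge0// sqr_ge0.
rewrite -integral_sqmod_comb//.
apply: ge0_le_integral => //.
- by move=> x _; rewrite lee_fin sqmod_ge0.
- exact: cLp_measurable_sqmod cc.
- apply/measurable_EFinP; apply: measurable_funD.
    by apply: measurable_funM => //; apply/measurable_EFinP.
  by apply: measurable_funM => //; apply/measurable_EFinP.
- by move=> x _; rewrite lee_fin sqmod_comb_le.
Qed.

End ComplexLp.

(** * The state space: inner product, norm and linear structure *)

Section States.
Context {R : realType} {N : nat}.
Variable Omega : set 'rV[R]_N.
Implicit Types (U V W : @state R N) (l m : R) (c e : R[i]).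

Lemma LL_comb p U V c e : (1 <= p)%E -> LL Omega p U -> LL Omega p V ->
  LL Omega p (scale c U + scale e V).
Proof. by move=> p1 [u1 u2] [v1 v2]; split; exact: cLp_comb. Qed.

Lemma LLB p U V : (1 <= p)%E -> LL Omega p U -> LL Omega p V ->
  LL Omega p (U - V).
Proof.
move=> p1 u v; rewrite (_ : U - V = scale 1 U + scale (-1) V).
  exact: LL_comb.
(* [change] exposes the pointwise values of each component, on which [ring] can work. *)
by apply: injective_projections; apply/funext => x;
  [change (U.1 x - V.1 x = 1 * U.1 x + -1 * V.1 x)
  |change (U.2 x - V.2 x = 1 * U.2 x + -1 * V.2 x)]; ring.
Qed.

Lemma inner_comb U V W l m :
  LL Omega 2%:E U -> LL Omega 2%:E V -> LL Omega 2%:E W ->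
  inner Omega (scale l%:C U + scale m%:C V) W =
  l * inner Omega U W + m * inner Omega V W.
Proof.
move=> [u1 u2] [v1 v2] [w1 w2]; rewrite /inner.
have E1 := Re_cint_comb l m u1 v1 w1.
have E2 := Re_cint_comb l m u2 v2 w2.
transitivity ((l * complex.Re (cint (dx Omega) (fun x => U.1 x * (W.1 x)^*)) +
  m * complex.Re (cint (dx Omega) (fun x => V.1 x * (W.1 x)^*))) +
  (l * complex.Re (cint (ds Omega) (fun x => U.2 x * (W.2 x)^*)) +
  m * complex.Re (cint (ds Omega) (fun x => V.2 x * (W.2 x)^*)))).
  by rewrite -E1 -E2.
ring.
Qed.

Lemma LLsq_ge0 U : (0 <= LLsq Omega U)%E.
Proof. by rewrite adde_ge0 ?L2sq_ge0. Qed.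

Lemma LL_LLsq_lty U : LL Omega 2%:E U -> (LLsq Omega U < +oo)%E.
Proof. by move=> [u1 u2]; rewrite lte_add_pinfty ?cLp_L2sq_lty. Qed.

Lemma mule_LLsq (k : \bar R) U :
  (k * LLsq Omega U = k * L2sq (dx Omega) U.1 + k * L2sq (ds Omega) U.2)%E.
Proof. by rewrite ge0_muleDr ?L2sq_ge0. Qed.

(** Lets the final comparison of costs take place between real numbers. *)
Lemma LL_LLsq_EFin U : LL Omega 2%:E U -> exists u : R, LLsq Omega U = u%:E.
Proof.
move=> U2; exists (fine (LLsq Omega U)).
by rewrite fineK// ge0_fin_numE ?LLsq_ge0// LL_LLsq_lty.
Qed.

Lemma LLsq_comb_le U V l m : LL Omega 2%:E U -> LL Omega 2%:E V ->
  (LLsq Omega (scale l%:C U + scale m%:C V)%R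
   <= (2 * l ^+ 2)%R%:E * LLsq Omega U + (2 * m ^+ 2)%R%:E * LLsq Omega V)%E.
Proof.
move=> [u1 u2] [v1 v2]; rewrite !mule_LLsq addeACA.
by apply: leeD; exact: L2sq_comb_le.
Qed.

Lemma LLsq_convex U V l m : 0 <= l -> 0 <= m -> l + m = 1 ->
  LL Omega 2%:E U -> LL Omega 2%:E V ->
  (LLsq Omega (scale l%:C U + scale m%:C V)%R
     + (l * m)%R%:E * LLsq Omega (U - V)%R
   = l%:E * LLsq Omega U + m%:E * LLsq Omega V)%E.
Proof.
move=> l0 m0 lm [u1 u2] [v1 v2].
rewrite !mule_LLsq addeACA [RHS]addeACA.
by congr (_ + _)%E; exact: L2sq_convex.
Qed.

(** Since the weights sum to one, [W] is split between the two terms: the misfit of a midpoint is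
    the midpoint of the misfits. *)
Lemma convex_combB U V W c e : c + e = 1 ->
  (scale c U + scale e V) - W = scale c (U - W) + scale e (V - W).
Proof.
move=> ce; have -> : e = 1 - c by rewrite -ce; ring.
by apply: injective_projections; apply/funext => x;
  [change (c * U.1 x + (1 - c) * V.1 x - W.1 x
     = c * (U.1 x - W.1 x) + (1 - c) * (V.1 x - W.1 x))
  |change (c * U.2 x + (1 - c) * V.2 x - W.2 x
     = c * (U.2 x - W.2 x) + (1 - c) * (V.2 x - W.2 x))]; ring.
Qed.

Lemma combB U V U' V' c e :
  (scale c U + scale e V) - (scale c U' + scale e V')
  = scale c (U - U') + scale e (V - V').
Proof.
by apply: injective_projections; apply/funext => x;
  [change (c * U.1 x + e * V.1 x - (c * U'.1 x + e * V'.1 x)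
     = c * (U.1 x - U'.1 x) + e * (V.1 x - V'.1 x))
  |change (c * U.2 x + e * V.2 x - (c * U'.2 x + e * V'.2 x)
     = c * (U.2 x - U'.2 x) + e * (V.2 x - V'.2 x))]; ring.
Qed.

(** The zeroth-order term and the source are jointly linear in state and source. The scalar [i] is
    arbitrary here and becomes the imaginary unit in the system. *)
Lemma potential_source_comb (a aG : 'rV[R]_N -> R[i]) U V F G i c e :
  scale i (potential a aG (scale c U + scale e V))
    - scale i (scale c F + scale e G)
  = scale c (scale i (potential a aG U) - scale i F)
    + scale e (scale i (potential a aG V) - scale i G).
Proof.
by apply: injective_projections; apply/funext => x;
  [change (i * (a x * (c * U.1 x + e * V.1 x)) - i * (c * F.1 x + e * G.1 x)
     = c * (i * (a x * U.1 x) - i * F.1 x)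
       + e * (i * (a x * V.1 x) - i * G.1 x))
  |change (i * (aG x * (c * U.2 x + e * V.2 x)) - i * (c * F.2 x + e * G.2 x)
     = c * (i * (aG x * U.2 x) - i * F.2 x)
       + e * (i * (aG x * V.2 x) - i * G.2 x))]; ring.
Qed.

Lemma LL_potential_source (a aG : 'rV[R]_N -> R[i]) U F i :
  LL Omega +oo%E (a, aG) -> LL Omega 2%:E U -> LL Omega 2%:E F ->
  LL Omega 2%:E (scale i (potential a aG U) - scale i F).
Proof.
move=> [a1 a2] [u1 u2] f2.
have two : (1 <= 2%:E :> \bar R)%E by rewrite lee_fin; lra.
have pU : LL Omega 2%:E (potential a aG U) by split; exact: cLpy_mul_cLp2.
rewrite (_ : _ - _ = scale i (potential a aG U) + scale (- i) F).
  exact: LL_comb.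
by apply: injective_projections; apply/funext => x;
  [change (i * (a x * U.1 x) - i * F.1 x = i * (a x * U.1 x) + - i * F.1 x)
  |change (i * (aG x * U.2 x) - i * F.2 x = i * (aG x * U.2 x) + - i * F.2 x)];
  ring.
Qed.

(** Linearity of the right side of the weak equation, where [W] stands for the image of [V] under
    the adjoint operator. *)
Lemma inner_generator_comb (a aG : 'rV[R]_N -> R[i]) U U' F F' V W i l m :
  LL Omega +oo%E (a, aG) -> LL Omega 2%:E V -> LL Omega 2%:E W ->
  LL Omega 2%:E U -> LL Omega 2%:E U' -> LL Omega 2%:E F -> LL Omega 2%:E F' ->
  inner Omega (scale l%:C U + scale m%:C U') W +
  inner Omega (scale i (potential a aG (scale l%:C U + scale m%:C U'))
    - scale i (scale l%:C F + scale m%:C F')) V =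
  l * (inner Omega U W
    + inner Omega (scale i (potential a aG U) - scale i F) V) +
  m * (inner Omega U' W
    + inner Omega (scale i (potential a aG U') - scale i F') V).
Proof.
move=> ha V2 W2 U2 U'2 F2 F'2; rewrite potential_source_comb.
have GU := LL_potential_source i ha U2 F2.
have GU' := LL_potential_source i ha U'2 F'2.
rewrite (inner_comb l m U2 U'2 W2) (inner_comb l m GU GU' V2).
by rewrite !mulrDr addrACA.
Qed.

End States.

(** * Superposition of weak solutions *)

Section Superposition.
Context {R : realType} {N : nat}.
Variables (Omega : set 'rV[R]_N) (T : R).
Implicit Types (F G Y Z : R -> @state R N) (l m : R) (c e : R[i]).

Local Notation comb l m Y Z := (fun t => scale l%:C (Y t) + scale m%:C (Z t)).

Lemma absolutely_continuous_comb (f g : R -> R) l m :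
  absolutely_continuous T f -> absolutely_continuous T g ->
  absolutely_continuous T (fun t => l * f t + m * g t).
Proof.
(* The summand 1 keeps [M] positive when both weights vanish and makes the last inequality
   strict. *)
move=> fT gT eps eps0; pose M := `|l| + `|m| + 1.
have M0 : 0 < M by rewrite /M ltr_wpDl// addr_ge0.
have [d1 d10 f1] := fT (eps / M) (divr_gt0 eps0 M0).
have [d2 d20 g2] := gT (eps / M) (divr_gt0 eps0 M0).
exists (Num.min d1 d2) => [|n a b ab disj]; first by rewrite lt_min d10.
rewrite lt_min => /andP[/(f1 n a b ab disj) fn /(g2 n a b ab disj) gn].
apply: (@le_lt_trans _ _ (`|l| * (eps / M) + `|m| * (eps / M))).
  apply: (@le_trans _ _ (`|l| * \sum_(k < n) `|f (b k) - f (a k)| +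
      `|m| * \sum_(k < n) `|g (b k) - g (a k)|)).
    rewrite !mulr_sumr -big_split/= ler_sum// => k _.
    rewrite -!normrM (le_trans _ (ler_normD _ _))//.
    by rewrite (_ : _ - _ = l * (f (b k) - f (a k)) + m * (g (b k) - g (a k)));
      [|ring].
  by rewrite lerD// ler_wpM2l// ltW.
rewrite -mulrDl mulrA ltr_pdivrMr// mulrC ltr_pM2l// /M ltrDl//.
Qed.

(** The definition evaluates functions only at interval endpoints, all of which lie in [[0, T]]. *)
Lemma eq_absolutely_continuous (f g : R -> R) :
  (forall t, t \in `[0, T] -> f t = g t) ->
  absolutely_continuous T f -> absolutely_continuous T g.
Proof.
move=> fg fT eps /fT[d d0 fd]; exists d => // n a b ab disj sd.
have := fd n a b ab disj sd; congr (_ < _); apply: eq_bigr => k _.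
have [a0 [akb bT]] := ab k (ltn_ord k).
by rewrite !fg// in_itv/= ?a0 ?bT ?(le_trans a0)// (le_trans akb).
Qed.

(** By contraposition, sources that differ as classes have a nonzero increment. *)
Lemma L2Teq_subr0 F G : L2Teq Omega T (G - F) 0 -> L2Teq Omega T F G.
Proof.
have eq_of_sub0 (u v : 'rV[R]_N -> R[i]) x : v x - u x = 0 -> u x = v x.
  by move=> /eqP; rewrite subr_eq0 => /eqP.
apply: aeS => t /[apply] -[h1 h2].
by split; [apply: aeS h1|apply: aeS h2] => x; exact: eq_of_sub0.
Qed.

Lemma continuous_in_time_comb Y Z l m :
  continuous_in_time Omega T Y -> continuous_in_time Omega T Z ->
  continuous_in_time Omega T (comb l m Y Z).
Proof.
move=> [Y2 Yc] [Z2 Zc].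
have two : (1 <= 2%:E :> \bar R)%E by rewrite lee_fin; lra.
split=> t tT; first by apply: LL_comb => //; [exact: Y2|exact: Z2].
(* The majorant from [LLsq_comb_le] for the increments; it tends to 0 as [s] tends to [t]. *)
pose C := (fun s => (2 * l ^+ 2)%R%:E * LLsq Omega (Y s - Y t)%R
  + (2 * m ^+ 2)%R%:E * LLsq Omega (Z s - Z t)%R)%E.
apply: (@squeeze_cvge _ _ _ _ (cst 0%E) _ C).
- near=> s.
  have sT : s \in `[0, T] by near: s; exact: withinT.
  rewrite LLsq_ge0/= combB; apply: LLsq_comb_le.
    by apply: LLB => //; exact: Y2.
  by apply: LLB => //; exact: Z2.
- exact: cvg_cst.
- rewrite -[X in _ --> X](_ : (2 * l ^+ 2)%R%:E * 0 + (2 * m ^+ 2)%R%:E * 0 = 0)%E;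
    last by rewrite !mule0 adde0.
  apply: cvgeD; first by rewrite !mule0.
    by apply: cvgeZl => //; exact: Yc.
  by apply: cvgeZl => //; exact: Zc.
Unshelve. all: by end_near. Qed.

Variables (d gamma : R) (r rG : 'I_N -> 'rV[R]_N -> R).
Variables (a aG : 'rV[R]_N -> R[i]).

(** The equation is linear in solution and source, the initial value is zero, and the test pairs are
    the same for every source. *)
Lemma weak_solution_comb F G Y Z l m : LL Omega +oo%E (a, aG) ->
  (forall t, t \in `]0, T[ -> LL Omega 2%:E (F t)) ->
  (forall t, t \in `]0, T[ -> LL Omega 2%:E (G t)) ->
  weak_solution Omega T d gamma r rG a aG F Y ->
  weak_solution Omega T d gamma r rG a aG G Z ->
  weak_solution Omega T d gamma r rG a aG (comb l m F G) (comb l m Y Z).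
Proof.
move=> ha F2 G2 [Yc Y0 Yw] [Zc Z0 Zw]; split.
- exact: continuous_in_time_comb.
- by case: Y0 Z0 => [y1 y2] [z1 z2]; split; exact: ae_comb0.
move=> V W VW; have [V2 W2 _] := VW.
have [Ya Yd] := Yw V W VW; have [Za Zd] := Zw V W VW.
(* Splitting the inner product requires square integrable states, which continuity in time provides
   on [[0, T]]. *)
have innerE t : t \in `[0, T] ->
    l * inner Omega (Y t) V + m * inner Omega (Z t) V
    = inner Omega (comb l m Y Z t) V.
  by move=> tT; rewrite inner_comb//; [exact: Yc.1|exact: Zc.1].
split.
  apply: eq_absolutely_continuous innerE _.
  exact: absolutely_continuous_comb.
apply: aeS2 Yd Zd => t Yt Zt tT.
have tT' : t \in `[0, T] by exact: subset_itv_oo_cc.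
have Dt := is_deriveD (is_deriveZ l (Yt tT)) (is_deriveZ m (Zt tT)).
(* As [t] is interior, the two functions agree in a neighbourhood and share their derivative. *)
apply: (near_eq_is_derive (f := fun s =>
    l * inner Omega (Y s) V + m * inner Omega (Z s) V)).
  near=> s; apply: innerE; apply: subset_itv_oo_cc.
  by near: s; exact: near_in_itvoo.
apply: is_derive_eq Dt _; apply/esym.
apply: inner_generator_comb => //; [exact: Yc.1|exact: Zc.1|exact: F2|exact: G2].
Unshelve. all: by end_near. Qed.

End Superposition.

(** * Two minimizers and their midpoint *)

Theorem lemma3p2 (R : realType) (N : nat) (hN : (1 <= N)%N)
    (Omega : set 'rV[R]_N) (hOmega : bounded_C2_domain Omega)
    (T : R) (hT : 0 < T)
    (d gamma : R) (hd : 0 < d) (hgamma : 0 < gamma)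
    (r rG : 'I_N -> 'rV[R]_N -> R)
    (hr : forall j, WW Omega 1 +oo%E (fun x => (r j x)%:C, fun x => (rG j x)%:C))
    (a aG : 'rV[R]_N -> R[i]) (ha : LL Omega +oo%E (a, aG))
    (UT : state) (hUT : LL Omega 2%:E UT)
    (FF : set (R -> state)) (FF_L2 : forall F, FF F -> L2T Omega T F)
    (FF_bounded : bounded_L2T Omega T FF)
    (FF_closed : closed_L2T Omega T FF) (FF_convex : convex_L2T FF)
    (VV : set (R -> state)) (VV_sub : VV `<=` FF)
    (VV_closed : closed_L2T Omega T VV) (VV_convex : convex_L2T VV)
    (hpos : forall F dF, VV F -> ~ L2Teq Omega T dF 0 -> VV (F + dF) ->
      forall Y YdF,
        weak_solution Omega T d gamma r rG a aG F Y ->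
        weak_solution Omega T d gamma r rG a aG (F + dF) YdF ->
        (0 < L2sq (dx Omega) ((YdF T).1 - (Y T).1)%R
             + L2sq (ds Omega) ((YdF T).2 - (Y T).2)%R)%E)
    (F1 F2 : R -> state) :
  VV F1 -> attains_inf_cost Omega T d gamma r rG a aG UT FF F1 ->
  VV F2 -> attains_inf_cost Omega T d gamma r rG a aG UT FF F2 ->
  L2Teq Omega T F1 F2.
Proof.
rewrite /attains_inf_cost; set J := ereal_inf _ => V1 [Y1 w1 J1] V2 [Y2 w2 J2].
apply: contrapT => F12.
have F12E : F1 + (F2 - F1) = F2 by rewrite addrC subrK.
have dF0 : ~ L2Teq Omega T (F2 - F1) 0.
  by move=> /L2Teq_subr0.
(* The positivity hypothesis at [F1] with increment [F2 - F1]. *)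
have pos : (0 < LLsq Omega (Y2 T - Y1 T)%R)%E.
  by apply: (hpos _ _ V1 dF0 _ _ _ w1); rewrite F12E.
(* The second weight is written [1 - 2^-1] throughout, as in [convex_L2T], so that sources and
   solutions carry the same coefficients. *)
have half : 0 <= (2^-1 : R) <= 1 by apply/andP; split; lra.
have V3 := VV_convex _ _ _ V2 V1 half.
have FL F : VV F -> forall t, t \in `]0, T[ -> LL Omega 2%:E (F t).
  by move=> /VV_sub/FF_L2[].
have w3 :=
  weak_solution_comb 2^-1 (1 - 2^-1) ha (FL _ V2) (FL _ V1) w2 w1.
have two : (1 <= 2%:E :> \bar R)%E by rewrite lee_fin; lra.
have TT : T \in `[0, T] by rewrite in_itv/= lexx ltW.
have Y1T : LL Omega 2%:E (Y1 T - UT).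
  by case: w1 => -[+ _] _ _ => /(_ T TT) ?; exact: LLB.
have Y2T : LL Omega 2%:E (Y2 T - UT).
  by case: w2 => -[+ _] _ _ => /(_ T TT) ?; exact: LLB.
have costE Y : (2^-1%:E * L2sq (dx Omega) ((Y T).1 - UT.1)%R
    + 2^-1%:E * L2sq (ds Omega) ((Y T).2 - UT.2)%R
  = 2^-1%:E * LLsq Omega (Y T - UT)%R)%E by rewrite mule_LLsq.
rewrite costE in J1; rewrite costE in J2.
(* The infimum is over [FF]; the midpoint competes because it lies in [VV], a subset of [FF]. *)
have J3 : (J <= 2^-1%:E * LLsq Omega
    (scale (2^-1)%:C (Y2 T) + scale (1 - 2^-1)%:C (Y1 T) - UT)%R)%E.
  apply: ereal_inf_lbound.
  exists (fun t => scale (2^-1)%:C (F2 t) + scale (1 - 2^-1)%:C (F1 t)).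
    exact: VV_sub.
  by eexists; [exact: w3|rewrite costE].
have midE : (2^-1)%:C + (1 - 2^-1)%:C = 1 :> R[i].
  by rewrite -rmorphD/= addrC subrK.
rewrite (convex_combB _ _ _ midE) in J3.
have h0 : 0 <= 2^-1 :> R by lra.
have h1 : 0 <= 1 - 2^-1 :> R by lra.
have hh : 2^-1 + (1 - 2^-1) = 1 :> R by lra.
(* The target [UT] cancels in the difference of the misfits, so the defect is a quarter of the
   squared norm of [Y2 T - Y1 T]. *)
have := LLsq_convex h0 h1 hh Y2T Y1T.
rewrite opprB addrA subrK.
have [x xE] := LL_LLsq_EFin (LL_comb (2^-1)%:C (1 - 2^-1)%:C two Y2T Y1T).
have [y1 y1E] := LL_LLsq_EFin Y1T.
have [y2 y2E] := LL_LLsq_EFin Y2T.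
have : LL Omega 2%:E (Y2 T - Y1 T).
  case: w1 w2 => -[+ _] _ _ [] -[+ _] _ _ => /(_ T TT) ? /(_ T TT) ?.
  exact: LLB.
move=> /LL_LLsq_EFin[z zE].
(* In real numbers: [y1 = y2], [y1 / 2 <= x / 2], [z > 0] and [x + z / 4 = (y1 + y2) / 2], which are
   incompatible. *)
move: J1 J2 J3 pos; rewrite xE y1E y2E zE => -> [] y12.
rewrite -!EFinM -!EFinD lte_fin lee_fin => xy z0 [].
lra.
Qed.
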